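(* Let $N\ge 1$ be an integer, let $\ell\in(0,1]$, and let $\{m_i^n\}_{0\le i\le n\le N}$ be nonnegative real numbers with $\sum_{i=0}^n m_i^n=1$ and $m_n^n>0$ for all $0\le n\le N$. Assume that (1) for all $0\le i<j\le N$, $m_i^j\le m_i^{j-1}$; (2) for all $0\le i<j\le N$, $\sum_{l=i}^{j-1}m_l^j\le m_i^i$. Let $\{(m_i^n)^M\}_{0\le i\le n\le N}$ be the M-dual coefficients of $\{m_i^n\}$. Then the worst-case residual bounds of the two corresponding Mann iterations coincide: $$R\big(\{m_i^n\}_{0\le i\le n\le N},\ell\big)=R\big(\{(m_i^n)^M\}_{0\le i\le n\le N},\ell\big).$$
   Context: For a real array $\{m_i^n\}_{0\le i\le n\le N}$ with $\sum_{i=0}^n m_i^n=1$ for every $n$, the M-dual coefficients are $$(m_i^j)^M=\sum_{k=0}^{j-i}m_{N-j+1+k}^{N-i+1}-\sum_{k=0}^{j-i-1}m_{N-j+1+k}^{N-i}\quad(1\le i\le j\le N),\qquad (m_0^j)^M=1-\sum_{r=1}^j (m_r^j)^M\quad(0\le j\le N)$$ (empty sums are $0$). $\mathcal L_\ell$ is the class of all operators $T:B\to B$, where $B$ is a nonempty convex subset of an arbitrary real normed space $(X,\|\cdot\|)$, such that $\|Tx-Ty\|\le \ell\|x-y\|$ for all $x,y\in B$. Given $T\in\mathcal L_\ell$, an initial point $x^0\in B$ and an array of nonnegative coefficients $\{a_i^n\}_{0\le i\le n\le N}$ with rows summing to $1$, the Mann iteration is $x^n=\sum_{i=0}^n a_i^n\,Tx^{i-1}$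 for $0\le n\le N$, with the notational convention $Tx^{-1}:=x^0$. The worst-case residual bound is $$R(\{a_i^n\},\ell)=\sup\frac{\|x^N-Tx^N\|}{\kappa},\qquad \kappa=\max_{-1\le i,j\le N}\|Tx^i-Tx^j\|,$$ where the supremum is over all $T\in\mathcal L_\ell$ (over all normed spaces and all nonempty convex domains $B$) and all $x^0\in B$, with $(x^n)$ the corresponding Mann iteration. Instances with $\kappa=0$ are excluded. *)

(* Defs.v *)
From HB Require Import structures.
From mathcomp Require Import all_boot all_order all_algebra.
From mathcomp Require Import all_classical all_reals all_analysis.
Set Implicit Arguments.
Unset Strict Implicit.
Unset Printing Implicit Defensive.
Import Order.TTheory GRing.Theory Num.Theory.
Import numFieldNormedType.Exports.
Local Open Scope classical_set_scope.
Local Open Scope ring_scope.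

(* A triangular array (a_i^n)_{0 <= i <= n <= N} is a function
   [a : nat -> nat -> R] with [a n i] standing for a_i^n (upper index first);
   values outside the triangle are irrelevant. *)

(* (m_i^j)^M for 1 <= i <= j <= N.  Under these bounds the natural number
   subtractions are exact, and for i = j the second sum is empty. *)
Definition Mdual_pos (R : realType) (N : nat) (m : nat -> nat -> R)
    (j i : nat) : R :=
  \sum_(0 <= k < (j - i).+1) m (N - i + 1)%N (N - j + 1 + k)%N
  - \sum_(0 <= k < j - i) m (N - i)%N (N - j + 1 + k)%N.

Definition Mdual (R : realType) (N : nat) (m : nat -> nat -> R)
    (j i : nat) : R :=
  if i == 0%N then 1 - \sum_(1 <= r < j.+1) Mdual_pos N m j r
  else Mdual_pos N m j i.

(* T : B -> B is represented by a map on the whole space whose values outside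
   B are unconstrained and, by [mann_in] below, never used. *)
Definition lip_operator (R : realType) (l : R) (X : normedModType R)
    (B : set X) (T : X -> X) : Prop :=
  [/\ B !=set0, convex_set B, set_fun B B T & l.-lipschitz_B T].

(* [Tprev T x i] is T x^{i-1}, with T x^{-1} := x^0. *)
Definition Tprev (R : realType) (X : normedModType R) (T : X -> X)
    (x : nat -> X) (i : nat) : X :=
  if i is k.+1 then T (x k) else x 0%N.

(* [x 0] is the initial point; the n = 0 equation holds since a_0^0 = 1. *)
Definition mann (R : realType) (N : nat) (a : nat -> nat -> R)
    (X : normedModType R) (T : X -> X) (x : nat -> X) : Prop :=
  forall n, (n <= N)%N -> x n = \sum_(0 <= i < n.+1) a n i *: Tprev T x i.

(* The maximum over -1 <= i, j <= N, shifted to 0 <= i, j <= N + 1; the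
   default value 0 is already attained for i = j. *)
Definition kappa (R : realType) (N : nat) (X : normedModType R) (T : X -> X)
    (x : nat -> X) : R :=
  \big[Num.max/0]_(0 <= i < N.+2) \big[Num.max/0]_(0 <= j < N.+2)
    `|Tprev T x i - Tprev T x j|.

Definition residual_ratios (R : realType) (N : nat) (a : nat -> nat -> R)
    (l : R) : set R :=
  [set r | exists (X : normedModType R) (B : set X) (T : X -> X)
                  (x : nat -> X),
     [/\ lip_operator l B T, B (x 0%N), mann N a T x, kappa N T x != 0 &
         r = `|x N - T (x N)| / kappa N T x] ].

Definition worst_residual (R : realType) (N : nat) (a : nat -> nat -> R)
    (l : R) : \bar R :=
  ereal_sup [set r%:E | r in residual_ratios N a l].

(* The remaining facts show that [worst_residual N (Mdual N m) l] is
   meaningful: the dual array is again nonnegative with rows summing to 1, and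
   for such arrays the iterates do not leave the domain B. *)

Lemma Mdual_posE (R : realType) (N : nat) (m : nat -> nat -> R)
    (hsum : forall n, (n <= N)%N -> \sum_(0 <= i < n.+1) m n i = 1)
    (j i : nat) : (1 <= i)%N -> (i <= j)%N -> (j <= N)%N ->
  Mdual_pos N m j i =
  \sum_(0 <= k < (N - j).+1) (m (N - i)%N k - m (N - i).+1 k).
Proof.
move=> i1 ij jN.
have tail n p : (n <= N)%N -> (N - j + p = n)%N ->
    \sum_(0 <= k < p) m n (N - j + 1 + k)%N
    = 1 - \sum_(0 <= k < (N - j).+1) m n k.
  move=> nN En; rewrite -(hsum n nN).
  rewrite [X in _ = X - _](@big_cat_nat _ _ _ (N - j).+1) //=; last first.
    by rewrite -En ltnS leq_addr.
  rewrite addrAC subrr add0r -[(N - j).+1]add0n big_addn.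
  have -> : (n.+1 - (N - j).+1 = p)%N by rewrite subSS -En addKn.
  apply: eq_bigr => k _; rewrite addn1 addnC //.
rewrite /Mdual_pos addn1 !tail.
- by rewrite sumrB opprB addrC addrA subrK.
- by rewrite leq_subr.
- by rewrite addnBA // subnK.
- by rewrite ltn_subrL i1 (leq_trans i1 (leq_trans ij jN)).
- by rewrite addnS addnBA // subnK.
Qed.

Lemma Mdual_sum1 (R : realType) (N : nat) (m : nat -> nat -> R) (j : nat) :
  \sum_(0 <= i < j.+1) Mdual N m j i = 1.
Proof.
rewrite big_nat_recl //= [X in _ + X](_ : _ =
  \sum_(1 <= r < j.+1) Mdual_pos N m j r) ?subrK //.
by rewrite [RHS]big_add1.
Qed.

Lemma Mdual_ge0 (R : realType) (N : nat) (m : nat -> nat -> R)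
    (hm0 : forall n i, (i <= n)%N -> (n <= N)%N -> 0 <= m n i)
    (hsum : forall n, (n <= N)%N -> \sum_(0 <= i < n.+1) m n i = 1)
    (hdecr : forall i j, (i < j)%N -> (j <= N)%N -> m j i <= m j.-1 i)
    (j i : nat) : (i <= j)%N -> (j <= N)%N -> 0 <= Mdual N m j i.
Proof.
move=> ij jN; rewrite /Mdual; case: eqP => [_|/eqP i0]; last first.
  rewrite -lt0n in i0; rewrite (Mdual_posE hsum) //.
  rewrite big_nat sumr_ge0 // => k /andP[_ kNj].
  rewrite subr_ge0; apply: (hdecr k (N - i).+1).
    by rewrite (leq_trans kNj) // ltnS leq_sub2l.
  by rewrite ltn_subrL i0 (leq_trans i0 (leq_trans ij jN)).
pose S n := \sum_(0 <= k < (N - j).+1) m n k.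
have -> : \sum_(1 <= r < j.+1) Mdual_pos N m j r = S (N - j)%N - S N.
  have := telescope_sumr (fun r => S (N - r)%N) (leq0n j).
  rewrite /= subn0 => <-; rewrite big_add1 /=.
  apply: eq_big_nat => r /andP[_ rj].
  rewrite (Mdual_posE hsum) // sumrB /S subnSK //.
  exact: leq_trans rj jN.
rewrite opprB addrA [1 + _]addrC -addrA {2}/S hsum ?leq_subr // subrr addr0.
rewrite /S big_nat sumr_ge0 // => k /andP[_ kNj].
by apply: hm0 => //; rewrite -ltnS (leq_trans kNj) // ltnS leq_subr.
Qed.

Lemma convex_comb (R : realType) (X : normedModType R) (B : set X)
    (cB : convex_set B) (n : nat) (c : nat -> R) (u : nat -> X)
    (c0 : forall i, (i <= n)%N -> 0 <= c i)
    (Bu : forall i, (i <= n)%N -> B (u i)) :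
  \sum_(0 <= i < n.+1) c i = 1 -> B (\sum_(0 <= i < n.+1) c i *: u i).
Proof.
elim: n c c0 Bu => [|n IH] c c0 Bu.
  by rewrite !big_nat1 => ->; rewrite scale1r; exact: Bu.
rewrite !(big_nat_recr n.+1) //=; set s := \sum_(_ <= _ < _) _ => hs.
have s0 : 0 <= s.
  by rewrite /s big_nat sumr_ge0 // => i /andP[_ ?]; apply: c0; exact: ltnW.
have [sz|snz] := eqVneq s 0.
  have cz i : (i <= n)%N -> c i = 0.
    move=> lein; apply/eqP; move/eqP: sz.
    rewrite /s big_mkord psumr_eq0 => [/allP /(_ (Ordinal (n:=n.+1) lein))|k _].
      by rewrite mem_index_enum /= => /(_ isT).
    by apply: c0; apply: ltnW.
  rewrite big_nat big1 => [|i /andP[_ ?]]; last by rewrite cz // scale0r.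
  by rewrite add0r -(add0r (c n.+1)) -sz hs scale1r; exact: Bu.
have cs1 : s <= 1 by rewrite -hs lerDl c0.
have := IH (fun i => c i / s); rewrite -mulr_suml divff // => Bw.
have {}Bw : B (\sum_(0 <= i < n.+1) (c i / s) *: u i).
  apply: Bw => // i lein; first by rewrite divr_ge0 // c0 // ltnW.
  by apply: Bu; exact: ltnW.
have s01 : 0 <= s <= 1 by rewrite s0.
have := cB _ _ (Itv01 s0 cs1) (mem_set Bw) (mem_set (Bu _ (leqnn _))).
move=> /set_mem; congr (B _).
rewrite /conv /= scaler_sumr; congr (_ + _).
  by apply: eq_bigr => i _; rewrite scalerA mulrCA divff // mulr1.
by congr (_ *: _); rewrite /unstable.onem -hs /=; rewrite addrAC subrr add0r.
Qed.

Lemma mann_in (R : realType) (N : nat) (a : nat -> nat -> R) (l : R)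
    (X : normedModType R) (B : set X) (T : X -> X) (x : nat -> X)
    (a0 : forall n i, (i <= n)%N -> (n <= N)%N -> 0 <= a n i)
    (asum : forall n, (n <= N)%N -> \sum_(0 <= i < n.+1) a n i = 1) :
  lip_operator l B T -> B (x 0%N) -> mann N a T x ->
  forall n, (n <= N)%N -> B (x n).
Proof.
case=> _ cB fT _ Bx0 hx; elim/ltn_ind => n IH nN.
rewrite hx //; apply: (convex_comb cB) => [i lein|[|i] lein|].
- exact: a0.
- exact: Bx0.
- by apply: fT; apply: IH => //; apply: leq_trans nN; exact: ltnW.
- exact: asum.
Qed.

(* Main.v *)
Require Import Defs.
From HB Require Import structures.
From mathcomp Require Import all_boot all_order all_algebra.
From mathcomp Require Import all_classical all_reals all_analysis.
From mathcomp Require Import ring lra zify.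
Set Implicit Arguments.
Unset Strict Implicit.
Unset Printing Implicit Defensive.
Import Order.TTheory GRing.Theory Num.Theory.
Import numFieldNormedType.Exports.
Local Open Scope classical_set_scope.
Local Open Scope ring_scope.

(** Write C n k for the sum of the first k entries of row n.

    Both worst-case residuals are computed exactly.  Let e(i,j) be the best
    bound on |T x^{i-1} - T x^{j-1}| when kappa = 1.  Then e(0,j) = 1, and
    e(i+1,j+1) is l times the cost of transporting row i of the array onto
    row j for the cost e.  For an [admissible] array an optimal plan is
    explicit ([transport]): the mass common to the two rows stays in place, the surplus
    at i fills the holes strictly between i and j, and the rest of the surplus
    goes to j.  Any plan gives an upper bound ([residual_le]).  This one is
    optimal because the consecutive differences g(i,j) = e(i,j) - e(i+1,j),
    the gaps, are nonnegative and decrease in j ([gap_ge0], [gap_antitone]);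
    so e satisfies the triangle and quadrangle inequalities, which make
    explicit Kantorovich potentials 1-Lipschitz ([potential_lipschitz]).
    Taking all these potentials as coordinates in a sup-normed matrix space,
    and extending by McShane the operator that the equations dictate, yields
    an instance that attains the bound ([residual_bound_attained]).  Hence R is
    the sum of the m_k^N e(k,N+1) ([worst_residualE]).

    It remains to see that this number is unchanged by duality.  In terms of
    C, the M-dual is the reflection in the antidiagonal,
    C' j k = C (N+1-k) (N+1-j) ([Mdual_antitranspose]); it preserves
    admissibility ([Mdual_admissible]).  The recursion of the distances e
    shows no symmetry, but that of the gaps does: its kernel
    ([transport_gap]) becomes its own transpose when the array is replaced by
    its dual and (i,j) by (N-j,N-i) ([transport_gap_antitranspose]).  So for
    gap solutions g and g' of an array and of its dual,
      sum_k g(k,N+1) g'(0,N+1-k) = sum_k g'(k,N+1) g(0,N+1-k)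
    ([pairing_sym]).  The residual bound pairs the exit values g(k,N+1) with
    the weights C N k.+1, and these are the dual entry values C' (N-k) 1.  The
    actual entry values of g are 1 - l + l C j 1, so g is a combination of the
    solution with entry values 1 and of the one with entry values C j 1; the
    pairing identity for these two solutions, together with e(0,N+1) = 1,
    gives the equality ([residual_bound_antitranspose]). *)

(** * Rows, transport costs and their differences *)

Definition cum (R : zmodType) (m : nat -> nat -> R) (n k : nat) : R :=
  \sum_(0 <= i < k) m n i.

Record admissible (R : realDomainType) (N : nat) (m : nat -> nat -> R) : Prop :=
  Admissible {
  adm_ge0 : forall n i, (i <= n)%N -> (n <= N)%N -> 0 <= m n i;
  adm_sum1 : forall n, (n <= N)%N -> cum m n n.+1 = 1;
  adm_decr : forall i j, (i < j)%N -> (j <= N)%N -> m j i <= m j.-1 i;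
  adm_tail : forall i j, (i < j)%N -> (j <= N)%N ->
       \sum_(i <= k < j) m j k <= m i i }.

(** What the surplus of row i at i leaves for j once it has filled the entries
    of row j strictly between i and j: for rows of sum 1 it equals
    m i i - (m j i + ... + m j j.-1).  In this cumulative form it is visibly
    invariant under the duality. *)
Definition slack (R : pzRingType) (m : nat -> nat -> R) (i j : nat) : R :=
  1 - cum m i i - cum m j j + cum m j i.

(** The cost for e of the nested plan: the holes that row i has strictly between
    i and j are filled from i, the nearest surplus, and all surplus that is left
    goes to j. *)
Definition transport (R : pzRingType) (m e : nat -> nat -> R) (i j : nat) : R :=
  \sum_(i.+1 <= l < j) m j l * e i l + slack m i j * e i j
  + \sum_(0 <= k < i) (m i k - m j k) * e k j.

(** The operator that [transport] induces on consecutive differences in the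
    first index. *)
Definition transport_gap (R : pzRingType) (m g : nat -> nat -> R)
    (i j : nat) : R :=
  \sum_(i.+1 <= l < j) m j l * g i l
  + \sum_(0 <= k < i) (cum m i k.+1 - cum m i.+1 k.+1) * g k j
  + slack m i.+1 j * g i j.

Definition dist (R : zmodType) (g : nat -> nat -> R) (i j : nat) : R :=
  \sum_(i <= k < j) g k j.

Section Algebra.
Variables (R : comNzRingType) (m : nat -> nat -> R).

Lemma cumS n k : cum m n k.+1 = cum m n k + m n k.
Proof. by rewrite /cum big_nat_recr. Qed.

Lemma sum_cum n i j : (i <= j)%N ->
  \sum_(i <= k < j) m n k = cum m n j - cum m n i.
Proof.
by move=> ij; rewrite /cum (big_cat_nat (leq0n i) ij) //= addrAC subrr add0r.
Qed.

Lemma dist_recl (g : nat -> nat -> R) i j : (i < j)%N ->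
  dist g i j = g i j + dist g i.+1 j.
Proof. by move=> ij; rewrite /dist big_ltn. Qed.

Lemma distnn (g : nat -> nat -> R) i : dist g i i = 0.
Proof. by rewrite /dist big_geq. Qed.

Lemma sum_cumM (w g : nat -> R) n :
  \sum_(0 <= k < n) w k * \sum_(k <= r < n) g r =
  \sum_(0 <= r < n) (\sum_(0 <= k < r.+1) w k) * g r.
Proof.
elim: n => [|n IH]; first by rewrite !big_geq.
rewrite big_nat_recr //= [RHS]big_nat_recr //= -IH big_nat1.
rewrite [in RHS]big_nat_recr //= mulrDl addrA; congr (_ + _).
rewrite mulr_suml -big_split /=; apply: eq_big_nat => k /andP[_ kn].
by rewrite big_nat_recr ?(ltnW kn) //= mulrDr.
Qed.

(** The terms of the two plans with the same target differ by gaps, except for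
    the origins k < i, where the masses change from m i k to m i.+1 k.  There
    e k j - e i j is itself a sum of gaps, and Abel summation turns the masses
    into partial sums. *)
Lemma transport_diff (g : nat -> nat -> R) i j : (i < j)%N ->
  transport m (dist g) i j - transport m (dist g) i.+1 j = transport_gap m g i j.
Proof.
move=> ij; rewrite /transport /transport_gap.
have first : \sum_(i.+1 <= l < j) m j l * dist g i l
   = \sum_(i.+1 <= l < j) m j l * g i l + \sum_(i.+2 <= l < j) m j l * dist g i.+1 l.
  have [E|lt] := eqVneq i.+1 j; first by rewrite !big_geq ?E ?addr0 //; lia.
  have {}lt : (i.+1 < j)%N by lia.
  rewrite [X in _ = _ + X](_ : _ = \sum_(i.+1 <= l < j) m j l * dist g i.+1 l).
    rewrite -big_split /=; apply: eq_big_nat => l /andP[il _].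
    by rewrite -mulrDr -dist_recl.
  by rewrite [RHS]big_ltn // distnn mulr0 add0r.
have third : \sum_(0 <= k < i) (m i k - m j k) * dist g k j
    - \sum_(0 <= k < i.+1) (m i.+1 k - m j k) * dist g k j
   = \sum_(0 <= k < i) (cum m i k.+1 - cum m i.+1 k.+1) * g k j
     + (cum m i i - cum m i.+1 i.+1 + m j i) * dist g i j.
  rewrite big_nat_recr //= opprD addrA -sumrB.
  transitivity (\sum_(0 <= k < i) (m i k - m i.+1 k) * \sum_(k <= r < i) g r j
    + (\sum_(0 <= k < i) (m i k - m i.+1 k)) * dist g i j
    - (m i.+1 i - m j i) * dist g i j).
    congr (_ - _); rewrite mulr_suml -big_split /=; apply: eq_big_nat => k /andP[_ ki].
    have -> : dist g k j = \sum_(k <= r < i) g r j + dist g i j.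
      by rewrite /dist -big_cat_nat // ltnW.
    ring.
  rewrite sum_cumM sumrB -!/(cum _ _ _) cumS -!addrA; congr (_ + _).
    by apply: eq_bigr => k _; rewrite sumrB.
  ring.
rewrite first (dist_recl g ij) in third *.
move: third; set T1 := \sum_(0 <= k < i) _; set T2 := \sum_(0 <= k < i.+1) _.
move=> /eqP; rewrite subr_eq => /eqP ->.
rewrite /slack !cumS; ring.
Qed.

Lemma sum_center (V : lmodType R) (y : nat -> V) (c : V) n : cum m n n.+1 = 1 ->
  \sum_(0 <= l < n.+1) m n l *: y l = c + \sum_(0 <= l < n.+1) m n l *: (y l - c).
Proof.
move=> s1; under [in RHS]eq_bigr do rewrite scalerBr.
by rewrite sumrB -scaler_suml -/(cum m n _) s1 scale1r addrC subrK.
Qed.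

(** The plan is a coupling of the two rows.  Applied to the vectors T x^k this
    bounds the distance of two iterates from above; applied to the values of a
    potential it computes the lower bound. *)
Lemma transport_decomp (V : lmodType R) (y : nat -> V) i j :
  cum m i i.+1 = 1 -> cum m j j.+1 = 1 -> (i < j)%N ->
  \sum_(0 <= l < j.+1) m j l *: y l - \sum_(0 <= l < i.+1) m i l *: y l =
  \sum_(i.+1 <= l < j) m j l *: (y l - y i) + slack m i j *: (y j - y i)
  + \sum_(0 <= k < i) (m i k - m j k) *: (y j - y k).
Proof.
move=> si sj ij.
have mj : m j j = 1 - cum m j j by rewrite -sj cumS addrC addKr.
rewrite (sum_center y (y i) si) (sum_center y (y i) sj) opprD addrACA subrr add0r.
rewrite (big_nat_recr j) //= (big_nat_recr i) //= subrr scaler0 addr0.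
rewrite (big_cat_nat (leq0n i) (ltnW ij)) //= (big_ltn ij) /=.
rewrite subrr scaler0 add0r mj.
have -> : \sum_(0 <= k < i) (m i k - m j k) *: (y j - y k)
   = \sum_(0 <= k < i) (m i k - m j k) *: (y j - y i)
   + (\sum_(0 <= k < i) m j k *: (y k - y i) - \sum_(0 <= k < i) m i k *: (y k - y i)).
  rewrite -sumrB -big_split /=; apply: eq_bigr => k _.
  rewrite -scalerBl -[m j k - _]opprB scaleNr -scalerBr; congr (_ *: _).
  by rewrite opprB addrA subrK.
rewrite -scaler_suml sumrB -!/(cum _ _ _) [RHS]addrA -[X in _ = X + _]addrA -scalerDl.
have -> : slack m i j + (cum m i i - cum m j i) = 1 - cum m j j.
  by rewrite /slack; ring.
by rewrite [RHS]addrA; congr (_ - _); rewrite -addrA addrC.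
Qed.
End Algebra.

(** * The gap recursion and its adjoint *)

Section Sums.
Variable V : nmodType.

Lemma sum_triangle (F : nat -> nat -> V) a b :
  \sum_(a <= j < b) \sum_(a <= l < j) F j l =
  \sum_(a <= l < b) \sum_(l.+1 <= j < b) F j l.
Proof.
have [ba|/ltnW/subnKC <-] := leqP b a; first by rewrite !big_geq.
elim: (b - a)%N => [|n IH]; first by rewrite addn0 !big_geq.
rewrite addnS (big_nat_recr (a + n)) ?leq_addr //= IH.
rewrite [RHS](big_nat_recr (a + n)) ?leq_addr //= [X in _ = _ + X]big_geq //.
rewrite addr0 -big_split /=; apply: eq_big_nat => l /andP[_ ?].
by rewrite [RHS]big_nat_recr.
Qed.

Lemma sum_reflect (F : nat -> V) a b c : (a <= b <= c)%N ->
  \sum_(c - b <= l < c - a) F l = \sum_(a.+1 <= k < b.+1) F (c - k)%N.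
Proof.
case/andP=> /subnKC <-; elim: (b - a)%N => [|n IH] le_c.
  by rewrite addn0 !big_geq.
rewrite addnS [RHS]big_nat_recr ?ltnS ?leq_addr //= -IH; last by lia.
have lt_c : (c - (a + n).+1 < c - a)%N by lia.
have E : (c - (a + n).+1).+1 = (c - (a + n))%N by lia.
by rewrite (big_ltn lt_c) E [LHS]addrC.
Qed.
End Sums.

Section Solution.
Variables (R : comNzRingType) (m : nat -> nat -> R) (l : R) (b : nat -> R).

(** The entry values g 0 j are left free: the duality argument uses solutions
    with three different entry rows. *)
Definition evolves (N : nat) (g : nat -> nat -> R) : Prop :=
  forall i j, (i < j)%N -> (j <= N)%N -> g i.+1 j.+1 = l * transport_gap m g i j.

Definition evolution_step (g : nat -> nat -> R) (i j : nat) : R :=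
  if i is k.+1 then l * transport_gap m g k j.-1 else b j.

(** Row i.+1 depends on the rows up to i only, so that row i is final after
    i.+1 steps. *)
Definition evolution (i : nat) : nat -> R :=
  iter i.+1 evolution_step (fun _ _ => 0) i.

Lemma eq_transport_gap (g h : nat -> nat -> R) i j :
  (forall k, (k <= i)%N -> g k =1 h k) -> transport_gap m g i j = transport_gap m h i j.
Proof.
move=> gh; rewrite /transport_gap; congr (_ + _ + _ * _); last exact: gh.
  by apply: eq_bigr => k _; rewrite gh.
by apply: eq_big_nat => k /andP[_ ki]; rewrite gh // ltnW.
Qed.

Lemma evolution0 j : evolution 0 j = b j. Proof. by []. Qed.

Lemma evolution_evolves N : evolves N evolution.
Proof.
have stable n p i : (i < n)%N -> (i < p)%N ->
    iter n evolution_step (fun _ _ => 0) i =1 iter p evolution_step (fun _ _ => 0) i.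
  elim: n p i => [|n IH] [|p] [|i] // ni pi j; congr (_ * _).
  by apply: eq_transport_gap => k ki; apply: IH; apply: leq_ltn_trans ki _.
move=> i j _ _; congr (_ * _); apply: eq_transport_gap => k ki.
exact: (stable i.+1 k.+1 k ki (ltnSn k)).
Qed.
End Solution.

Section Duality.
Variables (R : comNzRingType) (N : nat) (m m' : nat -> nat -> R).

(** Reflection of the partial sums in the antidiagonal.  Column k = 0 is left
    out because there all partial sums vanish. *)
Definition antitranspose : Prop :=
  forall j k, (0 < k)%N -> (k <= j.+1)%N -> (j <= N)%N ->
    cum m' j k = cum m (N.+1 - k) (N.+1 - j).

(** The transpose of [transport_gap m] for the pairing over 0 <= i < j <= N; see
    [transport_gap_adjoint]. *)
Definition cotransport_gap (h : nat -> nat -> R) i j : R :=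
  \sum_(i.+1 <= k < j) (cum m k i.+1 - cum m k.+1 i.+1) * h k j
  + \sum_(j.+1 <= k < N.+1) m k j * h i k + slack m i.+1 j * h i j.

(** The coefficients m j l are differences of C in its second argument, and
    C i k.+1 - C i.+1 k.+1 in its first.  The reflection exchanges the two kinds,
    hence moves of j with moves of i as transposition does, and the slack is
    invariant. *)
Lemma transport_gap_antitranspose (g : nat -> nat -> R) i j :
  antitranspose -> (i < j)%N -> (j <= N)%N ->
  transport_gap m' g (N - j) (N - i) =
  cotransport_gap (fun i j => g (N - j) (N - i))%N i j.
Proof.
move=> dual ij jN; rewrite /transport_gap /cotransport_gap; congr (_ + _ + _).
- have -> : (N - j).+1 = (N - j.-1)%N by lia.
  rewrite sum_reflect; last by lia.
  rewrite prednK; last by lia.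
  apply: eq_big_nat => k /andP[ik kj]; congr (_ * _).
  have -> : m' (N - i)%N (N - k)%N = cum m' (N - i) (N - k).+1 - cum m' (N - i) (N - k).
    by rewrite cumS addrC addKr.
  rewrite !dual; try lia.
  by congr (cum m _ _ - cum m _ _); lia.
- rewrite -{1}(subnn N) sum_reflect; last by lia.
  apply: eq_big_nat => k /andP[jk kN]; congr (_ * _); rewrite !dual; try lia.
  have -> : (N.+1 - (N - k).+1 = k)%N by lia.
  have -> : (N.+1 - (N - j) = j.+1)%N by lia.
  have -> : (N.+1 - (N - j).+1 = j)%N by lia.
  by rewrite cumS addrC addKr.
- rewrite /slack !dual; try lia.
  have -> : (N.+1 - (N - j).+1 = j)%N by lia.
  have -> : (N.+1 - (N - i) = i.+1)%N by lia.
  by rewrite [1 - _ - _]addrAC.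
Qed.

(** Exchange of summations over triangles: the moves of the second index are
    summed for i fixed, those of the first index for j fixed. *)
Lemma transport_gap_adjoint (h g : nat -> nat -> R) :
  \sum_(0 <= j < N.+1) \sum_(0 <= i < j) h i j * transport_gap m g i j =
  \sum_(0 <= j < N.+1) \sum_(0 <= i < j) cotransport_gap h i j * g i j.
Proof.
have row : \sum_(0 <= j < N.+1) \sum_(0 <= i < j)
      h i j * (\sum_(i.+1 <= k < j) m j k * g i k)
    = \sum_(0 <= j < N.+1) \sum_(0 <= i < j)
      (\sum_(j.+1 <= k < N.+1) m k j * h i k) * g i j.
  rewrite !sum_triangle; apply: eq_bigr => i _.
  transitivity (\sum_(i.+1 <= j < N.+1) \sum_(i.+1 <= k < j) h i j * (m j k * g i k)).
    by apply: eq_bigr => j _; rewrite mulr_sumr.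
  rewrite sum_triangle; apply: eq_bigr => k _; rewrite mulr_suml.
  by apply: eq_bigr => j _; ring.
have col : \sum_(0 <= j < N.+1) \sum_(0 <= i < j)
      h i j * (\sum_(0 <= k < i) (cum m i k.+1 - cum m i.+1 k.+1) * g k j)
    = \sum_(0 <= j < N.+1) \sum_(0 <= i < j)
      (\sum_(i.+1 <= k < j) (cum m k i.+1 - cum m k.+1 i.+1) * h k j) * g i j.
  apply: eq_bigr => j _.
  transitivity (\sum_(0 <= i < j) \sum_(0 <= k < i)
     h i j * ((cum m i k.+1 - cum m i.+1 k.+1) * g k j)).
    by apply: eq_bigr => i _; rewrite mulr_sumr.
  rewrite sum_triangle; apply: eq_bigr => k _; rewrite mulr_suml.
  by apply: eq_bigr => i _; ring.
rewrite /transport_gap /cotransport_gap.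
under eq_bigr do under eq_bigr do rewrite 2!mulrDr.
under [RHS]eq_bigr do under eq_bigr do rewrite 2!mulrDl.
under eq_bigr do rewrite !big_split /=.
under [RHS]eq_bigr do rewrite !big_split /=.
rewrite !big_split /= row col [X in _ = X + _]addrC; congr (_ + _).
by apply: eq_bigr => j _; apply: eq_bigr => i _; ring.
Qed.

(** Both sides complete the same sum over interior pairs: pair g with the
    reflection of g' over all 0 <= i < j <= N+1, and remove either the column
    j = N+1 or the row i = 0.  On what remains one of the two factors can be
    expanded by its recursion, and adjointness identifies the results. *)
Lemma pairing_sym (l : R) (g g' : nat -> nat -> R) :
  antitranspose -> evolves m l N g -> evolves m' l N g' ->
  \sum_(0 <= k < N.+1) g k N.+1 * g' 0%N (N.+1 - k)%N =
  \sum_(0 <= k < N.+1) g' k N.+1 * g 0%N (N.+1 - k)%N.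
Proof.
move=> dual eg eg'.
pose W := \sum_(0 <= j < N.+2) \sum_(0 <= i < j) g' (N.+1 - j)%N (N.+1 - i)%N * g i j.
have W1 : W = \sum_(0 <= k < N.+1) g k N.+1 * g' 0%N (N.+1 - k)%N
   + \sum_(0 <= j < N.+1) \sum_(0 <= i < j)
       l * (transport_gap m' g' (N - j) (N - i) * g i j).
  rewrite /W big_nat_recr //= subnn addrC; congr (_ + _).
    by apply: eq_bigr => k _; rewrite mulrC.
  apply: eq_big_nat => j /andP[_ jN]; apply: eq_big_nat => i /andP[_ ij].
  by rewrite !subSn; try lia; rewrite eg' ?mulrA //; lia.
have W2 : W = \sum_(0 <= k < N.+1) g' k N.+1 * g 0%N (N.+1 - k)%N
   + \sum_(0 <= j < N.+1) \sum_(0 <= i < j)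
       l * (g' (N - j)%N (N - i)%N * transport_gap m g i j).
  rewrite /W big_nat_recl //= [X in X + _]big_geq // add0r.
  rewrite [X in _ = X + _]big_nat_rev /= -big_split /=.
  apply: eq_big_nat => j /andP[_ jN]; rewrite big_nat_recl //; congr (_ + _).
    by rewrite subn0 add0n subSS; congr (_ * g _ _); lia.
  apply: eq_big_nat => i /andP[_ ij]; rewrite !subSS eg; try lia.
  by ring.
have : \sum_(0 <= j < N.+1) \sum_(0 <= i < j)
       l * (transport_gap m' g' (N - j) (N - i) * g i j) =
  \sum_(0 <= j < N.+1) \sum_(0 <= i < j)
       l * (g' (N - j)%N (N - i)%N * transport_gap m g i j).
  under eq_bigr do rewrite -mulr_sumr.
  under [RHS]eq_bigr do rewrite -mulr_sumr.
  rewrite -!mulr_sumr (transport_gap_adjoint (fun i j => g' (N - j) (N - i)))%N.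
  congr (_ * _); apply: eq_big_nat => j /andP[_ jN].
  by apply: eq_big_nat => i /andP[_ ij]; rewrite transport_gap_antitranspose.
by move=> E; move: W1; rewrite E W2 => /addIr ->.
Qed.
End Duality.

(** * Self-duality of the residual bound *)

Section Distances.
Variables (R : comNzRingType) (N : nat) (m : nat -> nat -> R) (l : R).
Hypothesis sum1 : forall n, (n <= N)%N -> cum m n n.+1 = 1.

(** Summing the gap recursion gives back the recursion of optimal transport
    between the iterates. *)
Lemma dist_evolves (g : nat -> nat -> R) i j :
    evolves m l N g -> (i <= j)%N -> (j <= N)%N ->
  dist g i.+1 j.+1 = l * transport m (dist g) i j.
Proof.
move=> eg /subnKC; move: (j - i)%N => d; elim: d i => [|d IH] i ij jN.
  rewrite -ij addn0 distnn /transport distnn big_geq // big1 => [|k _].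
    by rewrite mulr0 !addr0 mulr0.
  by rewrite subrr mul0r.
have lt_ij : (i < j)%N by lia.
rewrite dist_recl // eg // -(transport_diff _ _ lt_ij) IH ?addSnnS //.
by rewrite -mulrDr subrK.
Qed.

(** The entry values that make the distances from index 0 equal to 1
    ([dist_gap0]): e(1,j+1) = l (1 - m_0^j), because row 0 is a unit mass at 0
    and the mass m_0^j stays there. *)
Definition entry_gap (j : nat) : R :=
  if j is k.+1 then 1 - l + l * m k 0%N else 0.

Definition gap : nat -> nat -> R := evolution m l entry_gap.

Lemma gap_evolves : evolves m l N gap. Proof. exact: evolution_evolves. Qed.

Lemma dist_gap0 j : (0 < j)%N -> (j <= N.+1)%N -> dist gap 0 j = 1.
Proof.
elim/ltn_ind: j => -[//|j] IH _ jN.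
rewrite dist_recl // (dist_evolves gap_evolves) // /gap evolution0 /= -/gap.
have [->|j0] := posnP j.
  have := sum1 (leq0n N); rewrite cumS /cum big_geq // add0r => ->.
  by rewrite /transport /dist !big_geq //; ring.
have -> : transport m (dist gap) 0 j = 1 - m j 0%N.
  rewrite /transport [X in _ + X]big_geq // addr0 IH //; last by lia.
  rewrite (@eq_big_nat _ _ _ _ _ _ (fun k => m j k)) => [|k /andP[k0 kj]]; last first.
    by rewrite IH ?mulr1 //; lia.
  have c0 n : cum m n 0 = 0 by rewrite /cum big_geq.
  by rewrite sum_cum // /slack (cumS m j 0) !c0; ring.
ring.
Qed.

Definition residual_bound : R := \sum_(0 <= k < N.+1) m N k * dist gap k N.+1.

Lemma residual_by_gaps (g : nat -> nat -> R) :
  \sum_(0 <= k < N.+1) m N k * dist g k N.+1 =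
  \sum_(0 <= k < N.+1) g k N.+1 * cum m N k.+1.
Proof. by rewrite /dist sum_cumM; apply: eq_bigr => k _; rewrite mulrC. Qed.

Lemma transport_gap_linear (a b : R) (g h : nat -> nat -> R) i j :
  transport_gap m (fun i j => a * g i j + b * h i j) i j =
  a * transport_gap m g i j + b * transport_gap m h i j.
Proof.
have lin (c u v : nat -> R) p q : \sum_(p <= k < q) c k * (a * u k + b * v k)
    = a * (\sum_(p <= k < q) c k * u k) + b * (\sum_(p <= k < q) c k * v k).
  by rewrite !mulr_sumr -big_split /=; apply: eq_bigr => k _; ring.
rewrite /transport_gap (lin (m j) (g i) (h i)).
rewrite (lin (fun k => cum m i k.+1 - cum m i.+1 k.+1) (g^~ j) (h^~ j)); ring.
Qed.
End Distances.

Section DualValue.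
Variables (R : fieldType) (N : nat) (m m' : nat -> nat -> R) (l : R).
Hypothesis sum1 : forall n, (n <= N)%N -> cum m n n.+1 = 1.
Hypothesis sum1' : forall n, (n <= N)%N -> cum m' n n.+1 = 1.
Hypothesis l0 : l != 0.

Definition unit_gap (a : nat -> nat -> R) : nat -> nat -> R := evolution a l (fun=> 1).
(** The solution whose entry values are the first entries m j 0 of the rows
    ([share_gap0]), obtained by removing the constant part 1 - l of the entry
    values of [gap]. *)
Definition share_gap (a : nat -> nat -> R) i j : R :=
  l^-1 * gap a l i j + (- ((1 - l) / l)) * unit_gap a i j.

Lemma unit_gap_evolves (a : nat -> nat -> R) : evolves a l N (unit_gap a).
Proof. exact: evolution_evolves. Qed.

Lemma share_gap_evolves (a : nat -> nat -> R) : evolves a l N (share_gap a).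
Proof.
move=> i j ij jN; rewrite /share_gap transport_gap_linear (gap_evolves a l ij jN).
rewrite /unit_gap (evolution_evolves _ _ _ ij jN); ring.
Qed.

Lemma gapE (a : nat -> nat -> R) i j :
   gap a l i j = (1 - l) * unit_gap a i j + l * share_gap a i j.
Proof. by rewrite /share_gap; field. Qed.

Lemma share_gap0 (a : nat -> nat -> R) j : share_gap a 0 j.+1 = a j 0%N.
Proof. rewrite /share_gap /gap /unit_gap !evolution0 /=; field. exact: l0. Qed.

(** Write u and s for [unit_gap] and [share_gap], primes for the dual array,
    L for the pairing of exit values with the partial sums of row N, and E for
    the sum of the exit values.  The entry values of u are 1 and those of s' are
    the weights of L, so that [pairing_sym] gives E u = E u', L s = L' s',
    L u = E s' and L' u' = E s.  Since E of the full solution is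
    e(0,N+1) = 1 for both arrays, E s and E s' are the same affine function of
    E u = E u', whence L u = L' u'.  The value of L at the full solution, which
    is the residual bound, is the same combination of L u and L s on both
    sides. *)
Lemma residual_bound_antitranspose : antitranspose N m m' ->
  residual_bound N m l = residual_bound N m' l.
Proof.
move=> dual.
have pair := pairing_sym dual.
have cum1 (a : nat -> nat -> R) n : cum a n 1 = a n 0%N by rewrite /cum big_nat1.
have dual_entry k : (k < N.+1)%N -> m' (N - k)%N 0%N = cum m N k.+1.
  move=> kN; rewrite -cum1 dual //; last by lia.
  by congr (cum m _ _); lia.
have dual_exit k : (k < N.+1)%N -> m (N - k)%N 0%N = cum m' N k.+1.
  move=> kN; rewrite -cum1 dual //.
  by congr (cum m _ _); lia.
pose E (g : nat -> nat -> R) := dist g 0 N.+1.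
have unit0 a j : unit_gap a 0 j = 1 by [].
pose L (a g : nat -> nat -> R) := \sum_(0 <= k < N.+1) g k N.+1 * cum a N k.+1.
have u1 : E (unit_gap m) = E (unit_gap m').
  have := pair _ _ _ (@unit_gap_evolves m) (@unit_gap_evolves m').
  rewrite /E /dist; under eq_bigr do rewrite unit0 mulr1.
  by under [RHS]eq_bigr do rewrite unit0 mulr1.
have Elin a : (forall n, (n <= N)%N -> cum a n n.+1 = 1) ->
    E (share_gap a) = l^-1 - (1 - l) / l * E (unit_gap a).
  move=> s1; rewrite -[X in _ = X - _]mulr1.
  rewrite -[X in _ = _ * X - _](dist_gap0 l s1 (ltn0Sn N) (leqnn _)).
  by rewrite /E /dist !mulr_sumr -sumrB; apply: eq_bigr => k _; rewrite /share_gap; ring.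
have Llin a : L a (gap a l) = (1 - l) * L a (unit_gap a) + l * L a (share_gap a).
  by rewrite /L !mulr_sumr -big_split /=; apply: eq_bigr => k _; rewrite gapE; ring.
have Lu : L m (unit_gap m) = E (share_gap m').
  have := pair _ _ _ (@unit_gap_evolves m) (@share_gap_evolves m').
  rewrite /E /dist /L => H.
  rewrite (eq_big_nat _ _ (F2 := fun k => unit_gap m k N.+1 * share_gap m' 0 (N.+1 - k))).
    by rewrite H; apply: eq_bigr => k _; rewrite unit0 mulr1.
  by move=> k /andP[_ kN]; rewrite subSn // share_gap0 dual_entry.
have Lu' : L m' (unit_gap m') = E (share_gap m).
  have := pair _ _ _ (@share_gap_evolves m) (@unit_gap_evolves m').
  rewrite /E /dist /L => H.
  rewrite (eq_big_nat _ _ (F2 := fun k => unit_gap m' k N.+1 * share_gap m 0 (N.+1 - k))).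
    by rewrite -H; apply: eq_bigr => k _; rewrite unit0 mulr1.
  by move=> k /andP[_ kN]; rewrite subSn // share_gap0 dual_exit.
have Lf : L m (share_gap m) = L m' (share_gap m').
  have := pair _ _ _ (@share_gap_evolves m) (@share_gap_evolves m').
  rewrite /L => H.
  rewrite (eq_big_nat _ _ (F2 := fun k => share_gap m k N.+1 * share_gap m' 0 (N.+1 - k))).
    rewrite H; apply: eq_big_nat => k /andP[_ kN]; rewrite subSn // share_gap0 dual_exit //.
  by move=> k /andP[_ kN]; rewrite subSn // share_gap0 dual_entry.
rewrite /residual_bound !residual_by_gaps -!/(L _ _) !Llin Lf Lu Lu'.
by rewrite !Elin // u1.
Qed.
End DualValue.

(** * The M-dual array *)

Section MDual.
Variables (R : realType) (N : nat) (m : nat -> nat -> R).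
Hypothesis adm : admissible N m.

Lemma Mdual_entryE j i : (0 < i)%N -> (i <= j)%N -> (j <= N)%N ->
  Mdual N m j i = cum m (N - i) (N - j).+1 - cum m (N - i).+1 (N - j).+1.
Proof.
move=> i0 ij jN; rewrite /Mdual; case: eqP => [|_]; first by lia.
by rewrite (Mdual_posE (adm_sum1 adm)) // sumrB.
Qed.

(** The entries of row j of the dual are differences in r of the terms
    C (N+1-r) (N+1-j), so that their sums telescope. *)
Lemma Mdual_antitranspose : antitranspose N m (Mdual N m).
Proof.
move=> j k k0 kj jN.
have tail := sum_cum (Mdual N m) j kj.
rewrite [cum _ _ j.+1]Mdual_sum1 in tail.
pose f r := cum m (N.+1 - r) (N.+1 - j).
have tele := telescope_sumr f kj.
have E : \sum_(k <= r < j.+1) Mdual N m j r = \sum_(k <= r < j.+1) (f r.+1 - f r).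
  apply: eq_big_nat => r /andP[kr rj]; rewrite Mdual_entryE //; try lia.
  by rewrite /f subSS -!subSn //; lia.
have fj : f j.+1 = 1 by rewrite /f subSS subSn // (adm_sum1 adm) // leq_subr.
rewrite -/(f k); move: tail; rewrite E tele fj; lra.
Qed.

(** Both conditions are inequalities between partial sums that the reflection
    permutes: decrease says that the mixed second differences of C have a
    constant sign, and the tail condition that the slack is nonnegative. *)
Lemma Mdual_admissible : admissible N (Mdual N m).
Proof.
have dual := Mdual_antitranspose; split.
- by move=> n i; apply: Mdual_ge0; case: adm.
- by move=> n _; apply: Mdual_sum1.
- move=> i j ij jN; have [->|i0] := posnP i.
    have cum1 n : Mdual N m n 0 = cum (Mdual N m) n 1 by rewrite /cum big_nat1.
    rewrite !cum1 !dual //; try lia.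
    have -> : (N.+1 - j.-1 = (N.+1 - j).+1)%N by lia.
    by rewrite cumS lerDl (adm_ge0 adm); lia.
  rewrite !Mdual_entryE //; try lia.
  have -> : ((N - j.-1).+1 = (N - j).+2)%N by lia.
  rewrite [cum _ _ (N - j).+2]cumS [cum _ (N - i).+1 (N - j).+2]cumS.
  have := adm_decr adm (i := (N - j).+1) (j := (N - i).+1); rewrite /=.
  move=> /(_ ltac:(lia) ltac:(lia)); lra.
- move=> i j ij jN; rewrite sum_cum ?(ltnW ij) //.
  have mii : Mdual N m i i = 1 - cum (Mdual N m) i i.
    by have := Mdual_sum1 N m i; rewrite -/(cum _ _ _) cumS => <-; rewrite addrC addKr.
  rewrite mii; have [->|i0] := posnP i.
    have c0 n : cum (Mdual N m) n 0 = 0 by rewrite /cum big_geq.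
    rewrite !c0 !subr0 -(Mdual_sum1 N m j) -/(cum _ _ _) cumS lerDl.
    by apply: Mdual_ge0 => //; case: adm.
  rewrite !dual //; try lia.
  have := adm_tail adm (i := N.+1 - j) (j := N.+1 - i).
  move=> /(_ ltac:(lia) ltac:(lia)); rewrite sum_cum; last by lia.
  have := adm_sum1 adm (n := N.+1 - j); rewrite cumS => /(_ ltac:(lia)).
  lra.
Qed.
End MDual.

(** * Signs of the gaps and optimal potentials *)

Section Admissible.
Variables (R : realDomainType) (N : nat) (m : nat -> nat -> R).
Hypothesis adm : admissible N m.

Lemma adm_diag n : (n <= N)%N -> m n n = 1 - cum m n n.
Proof. by move=> nN; rewrite -(adm_sum1 adm nN) cumS addrC addKr. Qed.

Lemma adm_decr_le k i j : (k <= i)%N -> (i <= j)%N -> (j <= N)%N -> m j k <= m i k.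
Proof.
move=> ki /subnKC <-; elim: (j - i)%N => [|d IH]; first by rewrite addn0.
rewrite addnS => dN; apply: le_trans (IH (ltnW dN)).
by apply: (adm_decr adm) => //; rewrite ltnS (leq_trans ki) ?leq_addr.
Qed.

Lemma slack_ge0 i j : (i <= j)%N -> (j <= N)%N -> 0 <= slack m i j.
Proof.
move=> ij jN; rewrite /slack; have [<-|ne] := eqVneq i j.
  by rewrite addrAC addrK -adm_diag ?(adm_ge0 adm) //; lia.
have lt_ij : (i < j)%N by lia.
have := adm_tail adm lt_ij jN; rewrite sum_cum // adm_diag; last by lia.
lra.
Qed.

Lemma cum_decr i k : (k <= i)%N -> (i < N)%N -> cum m i.+1 k.+1 <= cum m i k.+1.
Proof.
move=> ki iN; rewrite /cum; apply: ler_sum_nat => r /andP[_ rk].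
by apply: (adm_decr adm); lia.
Qed.

Lemma transport_gap_ge0 (g : nat -> nat -> R) i j : (i < j)%N -> (j <= N)%N ->
  (forall k h, (k <= i)%N -> (k < h)%N -> (h <= j)%N -> 0 <= g k h) ->
  0 <= transport_gap m g i j.
Proof.
move=> ij jN g0; rewrite /transport_gap !addr_ge0 //.
- rewrite big_nat sumr_ge0 // => k /andP[ik kj].
  by rewrite mulr_ge0 ?(adm_ge0 adm) ?g0 //; lia.
- rewrite big_nat sumr_ge0 // => k /andP[_ ki].
  by rewrite mulr_ge0 ?subr_ge0 ?cum_decr ?g0 //; lia.
- by rewrite mulr_ge0 ?slack_ge0 ?g0.
Qed.

(** From j to j + 1 the coefficients of g i l with l < j decrease, and what they
    lose goes to l = j and l = j + 1, where g i is smaller. *)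
Lemma transport_gap_antitone (g : nat -> nat -> R) i j : (i < j)%N -> (j < N)%N ->
  (forall k h, (k <= i)%N -> (k < h)%N -> (h <= j)%N -> g k h.+1 <= g k h) ->
  transport_gap m g i j.+1 <= transport_gap m g i j.
Proof.
move=> ij jN g_anti.
have anti h : (i < h)%N -> (h <= j)%N -> g i j <= g i h.
  move=> ih /subnKC hj; move: (j - h)%N hj => d; elim: d h ih => [|d IH] h ih hj.
    by rewrite -hj addn0.
  apply: le_trans (g_anti i h _ _ _); rewrite ?leqnn //; last by lia.
  by apply: IH; lia.
have inner : \sum_(i.+1 <= k < j) (m j.+1 k - m j k) * g i k
    <= (\sum_(i.+1 <= k < j) (m j.+1 k - m j k)) * g i j.
  rewrite mulr_suml; apply: ler_sum_nat => k /andP[ik kj].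
  rewrite ler_wnM2l ?subr_le0 ?anti //; last by lia.
  by apply: (adm_decr adm); lia.
have outer : \sum_(0 <= k < i) (cum m i k.+1 - cum m i.+1 k.+1) * g k j.+1
    <= \sum_(0 <= k < i) (cum m i k.+1 - cum m i.+1 k.+1) * g k j.
  apply: ler_sum_nat => k /andP[_ ki].
  by rewrite ler_wpM2l ?subr_ge0 ?cum_decr ?g_anti //; lia.
have last_term : slack m i.+1 j.+1 * g i j.+1 <= slack m i.+1 j.+1 * g i j.
  by rewrite ler_wpM2l ?g_anti ?slack_ge0 //; lia.
(* Conservation: the coefficients of g i have the same sum for j and j + 1. *)
have total : \sum_(i.+1 <= k < j) (m j.+1 k - m j k)
    = slack m i.+1 j - slack m i.+1 j.+1 - m j.+1 j.
  by rewrite sumrB !sum_cum // /slack (cumS m j.+1 j); ring.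
rewrite /transport_gap big_nat_recr //=.
have split_inner : \sum_(i.+1 <= k < j) m j.+1 k * g i k = \sum_(i.+1 <= k < j) m j k * g i k
   + \sum_(i.+1 <= k < j) (m j.+1 k - m j k) * g i k.
  by rewrite -big_split /=; apply: eq_bigr => k _; ring.
rewrite total in inner.
rewrite split_inner; lra.
Qed.

(** The Kantorovich potential of the plan from i to j: it increases by exactly
    the cost along each shipment.  It has to stop growing at j, because the
    quadrangle inequality bounds its increase from k <= i to t by e k t for
    t <= j only. *)
Definition potential (l : R) (i j t : nat) : R :=
  if (t <= i)%N then dist (gap m l) i j - dist (gap m l) t j
  else dist (gap m l) i (minn t j).

(** Complementary slackness: the potential is tight on every route of the plan,
    hence its mean increases from row i to row j by the cost of the plan. *)
Lemma potential_transport (l : R) i j : (i < j)%N -> (j <= N)%N ->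
  \sum_(0 <= k < j.+1) m j k * potential l i j k
  - \sum_(0 <= k < i.+1) m i k * potential l i j k = transport m (dist (gap m l)) i j.
Proof.
move=> ij jN.
have := transport_decomp (potential l i j : nat -> R^o)
  (adm_sum1 adm (leq_trans (ltnW ij) jN)) (adm_sum1 adm jN) ij.
rewrite /GRing.scale /= => ->; rewrite /transport /potential leqnn subrr.
have -> : (j <= i)%N = false by lia.
rewrite minnn subr0; congr (_ + _ + _); apply: eq_big_nat => k /andP[k1 k2].
  have -> : (k <= i)%N = false by lia.
  by rewrite subr0 (minn_idPl (ltnW k2)).
by rewrite (ltnW k2); ring.
Qed.

End Admissible.

Section Signs.
Variables (R : realDomainType) (N : nat) (m : nat -> nat -> R) (l : R).
Hypothesis adm : admissible N m.
Hypotheses (l_ge0 : 0 <= l) (l_le1 : l <= 1).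

Lemma gap_ge0 i j : (i < j)%N -> (j <= N.+1)%N -> 0 <= gap m l i j.
Proof.
elim/ltn_ind: i j => -[|i] IH [|j] // ij jN.
  rewrite /gap evolution0 /= addr_ge0 ?subr_ge0 // mulr_ge0 // (adm_ge0 adm) //.
rewrite (@gap_evolves _ N m l i j ij jN) mulr_ge0 // (transport_gap_ge0 adm) //.
move=> k h ki kh hj.
by apply: IH; lia.
Qed.

Lemma gap_antitone i j : (i < j)%N -> (j <= N)%N -> gap m l i j.+1 <= gap m l i j.
Proof.
elim/ltn_ind: i j => -[|i] IH [|j] // ij jN.
  by rewrite /gap !evolution0 /= lerD2l ler_wpM2l // (adm_decr adm (j := j.+1)).
rewrite (@gap_evolves _ N m l i j ij (ltnW jN)).
rewrite (@gap_evolves _ N m l i j.+1 (leqW ij) jN).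
rewrite ler_wpM2l // (transport_gap_antitone adm) // => k h ki kh hj.
by apply: IH; lia.
Qed.

Lemma gap_antitone_le i a b : (i < a)%N -> (a <= b)%N -> (b <= N.+1)%N ->
  gap m l i b <= gap m l i a.
Proof.
move=> ia /subnKC <-; elim: (b - a)%N => [|d IH]; first by rewrite addn0.
by rewrite addnS => dN; apply: le_trans (gap_antitone _ _) (IH _); lia.
Qed.

Local Notation e := (dist (gap m l)).

Lemma dist_split k i j : (k <= i)%N -> (i <= j)%N ->
  e k j = \sum_(k <= r < i) gap m l r j + e i j.
Proof. by move=> ki ij; rewrite /dist (big_cat_nat ki ij). Qed.

(** Nested pairs cost at most as much as crossing pairs, because gaps decrease
    in the second index.  The degenerate case i = a is the triangle
    inequality. *)
Lemma dist_quadrangle k i a b :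
  (k <= i)%N -> (i <= a)%N -> (a <= b)%N -> (b <= N.+1)%N ->
  e k b + e i a <= e k a + e i b.
Proof.
move=> ki ia ab bN; rewrite (dist_split ki ia) (dist_split ki (leq_trans ia ab)).
rewrite -!addrA [e i a + _]addrC lerD2r; apply: ler_sum_nat => r /andP[_ ri].
by apply: gap_antitone_le => //; lia.
Qed.

Lemma dist_ge0 i j : (j <= N.+1)%N -> 0 <= e i j.
Proof.
move=> jN; rewrite /dist big_nat sumr_ge0 // => r /andP[_ rj].
exact: gap_ge0.
Qed.

Lemma dist_le_left k i b : (k <= i)%N -> (i <= b)%N -> (b <= N.+1)%N ->
  e i b <= e k b.
Proof.
move=> ki ib bN; rewrite (dist_split ki ib) lerDr big_nat sumr_ge0 // => r /andP[_ ri].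
by apply: gap_ge0 => //; lia.
Qed.

(** The quadrangle inequality with k = 0, as all distances from 0 are equal. *)
Lemma dist_le_right i a b : (i <= a)%N -> (a <= b)%N -> (b <= N.+1)%N ->
  e i a <= e i b.
Proof.
move=> ia ab bN; have [a0|a0] := posnP a.
  by move: ia; rewrite a0 leqn0 => /eqP ->; rewrite distnn dist_ge0.
have := dist_quadrangle (leq0n i) ia ab bN.
by rewrite !(dist_gap0 l (adm_sum1 adm)) ?lerD2l //; lia.
Qed.

Lemma dist_le1 i j : (i <= j)%N -> (j <= N.+1)%N -> e i j <= 1.
Proof.
move=> ij jN; have [j0|j0] := posnP j.
  by move: ij; rewrite j0 leqn0 => /eqP ->; rewrite distnn ler01.
by rewrite -(dist_gap0 l (adm_sum1 adm) j0 jN) dist_le_left.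
Qed.

Lemma dist_triangle i k j : (i <= k)%N -> (k <= j)%N -> (j <= N.+1)%N ->
  e i j <= e i k + e k j.
Proof.
by move=> ik kj jN; have := dist_quadrangle ik (leqnn k) kj jN; rewrite distnn addr0.
Qed.

(** On either side of i this is the triangle inequality, for k <= i < t <= j it
    is the quadrangle inequality, and the remaining cases follow by
    monotonicity of the distances. *)
Lemma potential_lipschitz i j k t :
  (i < j)%N -> (j <= N.+1)%N -> (k <= t)%N -> (t <= N.+1)%N ->
  `|potential m l i j k - potential m l i j t| <= e k t.
Proof.
move=> ij jN kt tN; rewrite /potential ler_norml.
have [ti|it] := leqP t i.
  rewrite (leq_trans kt ti).
  have := dist_triangle kt (leq_trans ti (ltnW ij)) jN.
  have := dist_le_left kt (leq_trans ti (ltnW ij)) jN.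
  have := @dist_ge0 k t tN; lra.
have [ki|ik] := leqP k i.
  have := dist_le_left ki (ltnW ij) jN.
  have := @dist_ge0 k t tN.
  have ge0 := @dist_ge0 i (minn t j) ltac:(lia).
  have [tj|jt] := leqP t j.
    have := dist_quadrangle ki (ltnW it) tj jN.
    by move: ge0; rewrite (minn_idPl tj); lra.
  have := dist_le_right (leq_trans ki (ltnW ij)) (ltnW jt) tN.
  by move: ge0; rewrite (minn_idPr (ltnW jt)); lra.
have mono := @dist_le_right i (minn k j) (minn t j) ltac:(lia) ltac:(lia) ltac:(lia).
have := @dist_ge0 k t tN.
have [tj|jt] := leqP t j.
  have := dist_triangle (ltnW ik) kt tN.
  by move: mono; rewrite (minn_idPl tj) (minn_idPl (leq_trans kt tj)); lra.
move: mono; rewrite (minn_idPr (ltnW jt)).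
have [kj|jk] := leqP k j; last by lra.
have := dist_triangle (ltnW ik) kj jN.
have := dist_le_right kj (ltnW jt) tN; lra.
Qed.

End Signs.

(** * The worst-case residual *)

Section Kappa.
Variables (R : realType) (N : nat) (X : normedModType R) (T : X -> X) (x : nat -> X).

Lemma le_kappa i j : (i <= N.+1)%N -> (j <= N.+1)%N ->
  `|Tprev T x i - Tprev T x j| <= kappa N T x.
Proof.
move=> iN jN.
have row := @le_bigmax_seq _ R _ (index_iota 0 N.+2) 0 j xpredT
  (fun j => `|Tprev T x i - Tprev T x j|).
have col := @le_bigmax_seq _ R _ (index_iota 0 N.+2) 0 i xpredT
  (fun i => \big[Num.max/0]_(0 <= j < N.+2) `|Tprev T x i - Tprev T x j|).
by apply: le_trans (row _ _) (col _ _); rewrite ?mem_index_iota.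
Qed.

Lemma kappa_le (c : R) : 0 <= c ->
  (forall i j, (i <= N.+1)%N -> (j <= N.+1)%N -> `|Tprev T x i - Tprev T x j| <= c) ->
  kappa N T x <= c.
Proof.
move=> c0 Tc; rewrite /kappa big_nat; apply: bigmax_le => // i /andP[_ iN].
by rewrite big_nat; apply: bigmax_le => // j /andP[_ jN]; apply: Tc.
Qed.
End Kappa.

Section Upper.
Variables (R : realType) (N : nat) (m : nat -> nat -> R) (l : R).
Hypothesis adm : admissible N m.
Hypotheses (l_ge0 : 0 <= l) (l_le1 : l <= 1).
Variables (X : normedModType R) (B : set X) (T : X -> X) (x : nat -> X).
Hypotheses (lipT : lip_operator l B T) (Bx0 : B (x 0%N)) (xT : mann N m T x).

(** Induction on i: two iterates are as close as the plan between their rows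
    allows, and T contracts by l. *)
Lemma Tprev_dist_le i j : (i <= j)%N -> (j <= N.+1)%N ->
  `|Tprev T x j - Tprev T x i| <= kappa N T x * dist (gap m l) i j.
Proof.
have sum1 := adm_sum1 adm.
elim/ltn_ind: i j => i IH j ij jN.
have [<-|ne] := eqVneq i j; first by rewrite subrr normr0 distnn mulr0.
have {ij}ij : (i < j)%N by lia.
case: i => [|i] in IH ij ne *.
  by rewrite (dist_gap0 l sum1) // mulr1 le_kappa.
case: j => // j in ij jN ne *; rewrite ltnS in jN.
have lt_ij : (i < j)%N by [].
have in_B := mann_in (adm_ge0 adm) (adm_sum1 adm) lipT Bx0 xT.
case: lipT => _ _ _ lip.
have := lip (x j, x i) (conj (in_B _ jN) (in_B _ (leq_trans (ltnW lt_ij) jN))).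
move=> /= /le_trans; apply.
rewrite (dist_evolves (@gap_evolves _ N m l)) //; last by lia.
rewrite mulrCA ler_wpM2l //.
have iN : (i <= N)%N by lia.
rewrite (xT jN) (xT iN) (transport_decomp _ (sum1 _ iN) (sum1 _ jN) lt_ij).
rewrite /transport !mulrDr.
have step (c : R) k h : 0 <= c -> (k <= i)%N -> (k <= h)%N -> (h <= N.+1)%N ->
    `|c *: (Tprev T x h - Tprev T x k)| <= kappa N T x * (c * dist (gap m l) k h).
  by move=> c0 ki kh hN; rewrite normrZ ger0_norm // mulrCA ler_wpM2l // IH.
apply: le_trans (ler_normD _ _) _; apply: lerD.
  apply: le_trans (ler_normD _ _) _; apply: lerD.
    apply: le_trans (ler_norm_sum _ _ _) _; rewrite mulr_sumr.
    apply: ler_sum_nat => k /andP[k1 k2]; apply: step; rewrite ?(adm_ge0 adm) //; lia.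
  by apply: step; rewrite ?(slack_ge0 adm) //; lia.
apply: le_trans (ler_norm_sum _ _ _) _; rewrite mulr_sumr.
apply: ler_sum_nat => k /andP[k1 k2]; apply: step; rewrite ?subr_ge0; try lia.
by apply: (adm_decr_le adm); lia.
Qed.

Lemma residual_le : `|x N - T (x N)| <= kappa N T x * residual_bound N m l.
Proof.
rewrite [X in `|X - _|](xT (leqnn N)) (sum_center _ (T (x N)) (adm_sum1 adm (leqnn N))).
rewrite addrAC subrr add0r; apply: le_trans (ler_norm_sum _ _ _) _.
rewrite /residual_bound mulr_sumr; apply: ler_sum_nat => k /andP[_ kN].
rewrite normrZ ger0_norm ?(adm_ge0 adm) // mulrCA ler_wpM2l ?(adm_ge0 adm) //.
by rewrite distrC; apply: (@Tprev_dist_le k N.+1); lia.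
Qed.
End Upper.

Section Mx.
Variables (R : realType) (p q : nat).
Lemma entry_le_mxnorm (A : 'M[R]_(p.+1, q.+1)) a b : `|A a b| <= `|A|.
Proof.
rewrite [leRHS]/Num.norm /= mx_normrE.
exact: (le_bigmax 0 (fun ij => `|A ij.1 ij.2|) (a, b)).
Qed.

Lemma mxnorm_le (A : 'M[R]_(p.+1, q.+1)) c : (forall a b, `|A a b| <= c) -> `|A| <= c.
Proof.
move=> Ac; rewrite [leLHS]/Num.norm /= mx_normrE; apply: bigmax_le => //.
exact: le_trans (Ac ord0 ord0).
Qed.
End Mx.

(** McShane extension: take the least of the functions
    u |-> c i + l * `|u - p i|, which all are l-Lipschitz. *)
Lemma mcshane (R : realType) (V : normedModType R) (l : R) (n : nat)
    (p : nat -> V) (c : nat -> R) : 0 <= l ->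
  (forall i j, (i <= n)%N -> (j <= n)%N -> c i - c j <= l * `|p i - p j|) ->
  exists f : V -> R, (forall u v, `|f u - f v| <= l * `|u - v|) /\
    (forall i, (i <= n)%N -> f (p i) = c i).
Proof.
move=> l0 lip; pose h u (i : 'I_n.+1) := c i + l * `|u - p i|.
have least u : exists i, forall j, h u i <= h u j.
  by case: (@arg_minP _ _ _ ord0 xpredT (h u) isT) => i _ hi; exists i => j; apply: hi.
have [a aP] := choice least; exists (fun u => h u (a u)); split=> [u v|i lein].
  have half u' v' : h u' (a u') - h v' (a v') <= l * `|u' - v'|.
    rewrite lerBlDr; apply: le_trans (aP u' (a v')) _.
    rewrite /h addrCA lerD2l -mulrDr ler_wpM2l //.
    by rewrite -[u' - p _](subrKA v') ler_normD.
  by rewrite ler_norml half andbT lerNl opprB distrC half.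
apply/eqP; rewrite eq_le; apply/andP; split.
  have := aP (p i) (Ordinal (lein : (i < n.+1)%N)).
  by rewrite {2}/h /= subrr normr0 mulr0 addr0.
by rewrite /h -lerBlDl lip // -ltnS.
Qed.

Section Lower.
Variables (R : realType) (N : nat) (m : nat -> nat -> R) (l : R).
Hypothesis adm : admissible N m.
Hypotheses (l_ge0 : 0 <= l) (l_le1 : l <= 1).

(** The values T x^{k-1} of the extremal instance, with the potential of the
    pair (a, b) as entry (a, b).  The entries with b <= a hold the distance from
    index 0, which separates the points 0 and 1, so that kappa = 1. *)
Definition extremal_point (k : nat) : 'M[R]_(N.+2) :=
  \matrix_(a, b) if (a < b)%N then potential m l a b k else (0 < k)%:R.

Definition extremal_iterate (n : nat) : 'M[R]_(N.+2) :=
  \sum_(0 <= i < n.+1) m n i *: extremal_point i.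

Lemma extremal_point_dist k t : (k <= t)%N -> (t <= N.+1)%N ->
  `|extremal_point k - extremal_point t| <= dist (gap m l) k t.
Proof.
move=> kt tN; apply: mxnorm_le => a b; rewrite !mxE.
case: ifP => ab.
  by apply: (potential_lipschitz adm) => //; rewrite -ltnS.
have [k0|k0] := posnP k; last first.
  by rewrite (leq_trans k0 kt) subrr normr0 (dist_ge0 adm).
rewrite k0 in kt *; have [->|t0] := posnP t; first by rewrite subrr normr0 distnn.
by rewrite (dist_gap0 l (adm_sum1 adm)) // sub0r normrN1.
Qed.

Lemma extremal_iterate_dist i j : (i < j)%N -> (j <= N)%N ->
  transport m (dist (gap m l)) i j <= `|extremal_iterate j - extremal_iterate i|.
Proof.
move=> ij jN.
have iN2 : (i < N.+2)%N by lia.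
have jN2 : (j < N.+2)%N by lia.
apply: le_trans (entry_le_mxnorm _ (Ordinal iN2) (Ordinal jN2)).
rewrite -(potential_transport adm) // /extremal_iterate !mxE !summxE.
under [X in _ <= `|X - _|]eq_bigr do rewrite !mxE /= ij.
under [X in _ <= `|_ - X|]eq_bigr do rewrite !mxE /= ij.
exact: ler_norm.
Qed.

(** Sending each iterate to the next extremal point is l-Lipschitz, since the
    potentials make the distance of two iterates at least the transport cost of
    their rows.  In the sup norm it extends entrywise to the whole space. *)
Lemma extremal_operator : exists T : 'M[R]_(N.+2) -> 'M[R]_(N.+2),
  lip_operator l [set: 'M[R]_(N.+2)] T /\
  forall i, (i <= N)%N -> T (extremal_iterate i) = extremal_point i.+1.
Proof.
have lip i j : (i <= N)%N -> (j <= N)%N ->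
    `|extremal_point i.+1 - extremal_point j.+1|
      <= l * `|extremal_iterate i - extremal_iterate j|.
  wlog ij : i j / (i <= j)%N => [H iN jN|iN jN].
    by have [ij|/ltnW ji] := leqP i j; [|rewrite distrC [X in _ <= _ * X]distrC]; apply: H.
  apply: le_trans (extremal_point_dist _ _) _ => //.
  rewrite (dist_evolves (@gap_evolves _ N m l)) // ler_wpM2l //.
  have [<-|ne] := eqVneq i j.
    by rewrite subrr normr0 /transport big_geq // distnn big1 ?mulr0 ?addr0 // => k _;
      rewrite subrr mul0r.
  by rewrite distrC; apply: extremal_iterate_dist => //; lia.
have ext (ab : 'I_N.+2 * 'I_N.+2) : exists f : 'M[R]_(N.+2) -> R,
    (forall u v, `|f u - f v| <= l * `|u - v|) /\
    (forall i, (i <= N)%N -> f (extremal_iterate i) = extremal_point i.+1 ab.1 ab.2).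
  apply: mcshane => // i j iN jN; apply: le_trans (lip _ _ iN jN).
  apply: le_trans (ler_norm _) _.
  by have := entry_le_mxnorm (extremal_point i.+1 - extremal_point j.+1) ab.1 ab.2; rewrite !mxE.
have [f fP] := choice ext.
exists (fun z => \matrix_(a, b) f (a, b) z); split; last first.
  by move=> i iN; apply/matrixP => a b; rewrite mxE; apply: (fP (a, b)).2.
split=> //; first by exists 0.
move=> [u v] _ /=; apply: mxnorm_le => a b; rewrite !mxE; exact: (fP (a, b)).1.
Qed.

(** The residual is read off in the entry of the pair (N, N+1): the potential
    drops by e(k,N+1) from N+1 to each k <= N, hence by their weighted sum from
    T x^N to x^N. *)
Lemma residual_bound_attained : exists2 r,
  residual_ratios N m l r & residual_bound N m l <= r.
Proof.
have [T [lipT Tx]] := extremal_operator.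
pose x := extremal_iterate; pose y := extremal_point.
have m00 : m 0%N 0%N = 1 by have := adm_sum1 adm (leq0n N); rewrite /cum big_nat1.
have x0 : x 0%N = y 0%N by rewrite /x /extremal_iterate big_nat1 m00 scale1r.
have Tprev_y i : (i <= N.+1)%N -> Tprev T x i = y i.
  by case: i => [|i] iN //=; apply: Tx.
have kappa_le1 : kappa N T x <= 1.
  apply: kappa_le => // i j iN jN; rewrite !Tprev_y //.
  wlog ij : i j iN jN / (i <= j)%N => [H|].
    by have [ij|/ltnW ji] := leqP i j; [|rewrite distrC]; apply: H.
  exact: le_trans (extremal_point_dist ij jN) (dist_le1 adm _ _ ij jN).
have kappa_ge1 : 1 <= kappa N T x.
  apply: le_trans (@le_kappa _ N _ T x 0 1 _ _) => //.
  rewrite !Tprev_y //; apply: le_trans (entry_le_mxnorm _ ord0 ord0).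
  by rewrite !mxE /= sub0r normrN1.
have kappa1 : kappa N T x = 1 by apply/eqP; rewrite eq_le kappa_le1.
exists (`|x N - T (x N)| / kappa N T x).
  exists 'M[R]_(N.+2), [set: 'M[R]_(N.+2)], T, x; split=> //; last first.
    by rewrite kappa1 oner_neq0.
  move=> n nN; rewrite {1}/x /extremal_iterate; apply: eq_big_nat => i /andP[_ lein].
  by rewrite Tprev_y //; lia.
rewrite kappa1 divr1 Tx //.
have NN2 : (N < N.+2)%N by [].
apply: le_trans (entry_le_mxnorm _ (Ordinal NN2) ord_max).
rewrite {1}/x /extremal_iterate (sum_center _ (y N.+1) (adm_sum1 adm (leqnn N))).
rewrite addrAC subrr add0r summxE -normrN; apply: le_trans (ler_norm _).
rewrite -sumrN /residual_bound; apply: ler_sum_nat => k /andP[_ kN].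
rewrite !mxE /= ltnS leqnn /potential ltnn minnn -ltnS kN.
by rewrite [_ - _ - _]addrAC subrr sub0r mulrN opprK.
Qed.

End Lower.

Lemma worst_residualE (R : realType) (N : nat) (m : nat -> nat -> R) (l : R) :
  admissible N m -> 0 <= l -> l <= 1 ->
  worst_residual N m l = (residual_bound N m l)%:E.
Proof.
move=> adm l0 l1; apply/eqP; rewrite eq_le; apply/andP; split.
  apply: ge_ereal_sup => _ [r [X [B [T [x [lipT Bx0 xT k0 ->]]]]] <-].
  have k_gt0 : 0 < kappa N T x.
    by rewrite lt_neqAle eq_sym k0 (le_trans (normr_ge0 _) (@le_kappa _ N _ T x 0 0 _ _)).
  rewrite lee_fin ler_pdivrMr // mulrC; exact: residual_le lipT Bx0 xT.
have [r rP le_r] := @residual_bound_attained R N m l adm l0 l1.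
apply: (@le_trans _ _ r%:E); first by rewrite lee_fin.
by apply: ereal_sup_ubound; exists r.
Qed.

Theorem theorem1 (R : realType) (N : nat) (l : R) (m : nat -> nat -> R)
    (hN : (1 <= N)%N)
    (hl0 : 0 < l) (hl1 : l <= 1)
    (hm0 : forall n i, (i <= n)%N -> (n <= N)%N -> 0 <= m n i)
    (hsum : forall n, (n <= N)%N -> \sum_(0 <= i < n.+1) m n i = 1)
    (hdiag : forall n, (n <= N)%N -> 0 < m n n)
    (hdecr : forall i j, (i < j)%N -> (j <= N)%N -> m j i <= m j.-1 i)
    (htail : forall i j, (i < j)%N -> (j <= N)%N ->
       \sum_(i <= k < j) m j k <= m i i) :
  worst_residual N m l = worst_residual N (Mdual N m) l.
Proof.
have adm : admissible N m by split.
have adm' := Mdual_admissible adm.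
rewrite !worst_residualE // ?ltW //; congr (_%:E).
apply: residual_bound_antitranspose (Mdual_antitranspose adm).
- exact: (adm_sum1 adm).
- exact: (adm_sum1 adm').
- by rewrite gt_eqF.
Qed.
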